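(* For the cycle $C_n$ of order $n\ge 3$, $$IC(C_n)=\begin{cases} n & \text{if } n\le 6;\\ 5 & \text{if } n=7;\\ 6 & \text{if } n\ge 8.\end{cases}$$
   Context: Graphs are finite and simple. $C_n$ denotes the cycle with $n$ vertices. A set $S$ of vertices is dominating if every vertex is in $S$ or adjacent to a vertex of $S$; it is independent if its vertices are pairwise nonadjacent; an independent dominating set is a set that is both independent and dominating. An independent coalition in $G$ consists of two disjoint independent sets of vertices $V_1,V_2$, neither of which is an independent dominating set but whose union $V_1\cup V_2$ is an independent dominating set; one says that $V_1$ and $V_2$ form an independent coalition. An $ic$-partition of $G$ is a partition $\pi=\{V_1,\dots,V_k\}$ of $V(G)$ into nonempty sets such that every $V_i\in\pi$ either is a singleton dominating set (a dominating set of cardinality 1), or is not an independent dominating set but forms an independent coalition with another set $V_j\in\pi$. The independent coalition number $IC(G)$ is the maximum number of classes of an $ic$-partition of $G$; the assertion $IC(G)=t$ includes that $G$ has an $ic$-partition. *)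

(* Defs.v *)
From mathcomp Require Import all_boot.
Set Implicit Arguments.
Unset Strict Implicit.
Unset Printing Implicit Defensive.

Record sgraph := SGraph {
  vertex :> finType;
  adj : rel vertex;
  adj_sym : symmetric adj;
  adj_irrefl : irreflexive adj }.

Section IndependentCoalition.
Variable G : sgraph.
Implicit Types (S V W : {set G}) (P : {set {set G}}).

Definition dominating S : bool :=
  [forall v, (v \in S) || [exists u in S, adj v u]].

Definition independent S : bool :=
  [forall u in S, forall v in S, ~~ adj u v].

Definition ind_dominating S : bool := independent S && dominating S.

Definition ind_coalition V W : bool :=
  [&& [disjoint V & W], independent V, independent W,
      ~~ ind_dominating V, ~~ ind_dominating W & ind_dominating (V :|: W)].

(* [partition] already excludes empty classes. *)
Definition ic_partition P : bool :=
  partition P [set: G] &&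
  [forall V in P,
     (#|V| == 1) && dominating V
     || ~~ ind_dominating V && [exists W in P :\ V, ind_coalition V W]].

(* This maximum is 0 when [G] has no ic-partition, so asserting a value for the
   independent coalition number also requires [has_ic_partition]. *)
Definition IC : nat := \max_(P : {set {set G}} | ic_partition P) #|P|.

Definition has_ic_partition : Prop := exists P, ic_partition P.

End IndependentCoalition.

(* The clause [i != j] only removes the loop that the successor relation modulo
   n would have for n = 1. *)
Definition cycle_adj n : rel 'I_n := fun i j =>
  (i != j) && ((j == i.+1 %[mod n]) || (i == j.+1 %[mod n])).

Lemma cycle_adj_sym n : symmetric (@cycle_adj n).
Proof. by move=> i j; rewrite /cycle_adj eq_sym orbC. Qed.

Lemma cycle_adj_irrefl n : irreflexive (@cycle_adj n).
Proof. by move=> i; rewrite /cycle_adj eqxx. Qed.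

Definition cycle_graph n : sgraph :=
  SGraph (@cycle_adj_sym n) (@cycle_adj_irrefl n).

(* Main.v *)
Require Import Defs.
From mathcomp Require Import all_boot zify.
Set Implicit Arguments.
Unset Strict Implicit.
Unset Printing Implicit Defensive.

(** Upper bounds.  Let [P] be an ic-partition of a cycle with at least 4
    vertices, and join two classes when they form an independent coalition.  No
    singleton dominates, so every class has a partner.  For any vertex [v], the
    at most three classes meeting the closed neighbourhood of [v] cover all
    edges of this coalition graph, because the union of two partners dominates
    [v].  Taking for [v] a vertex that a class [V] leaves undominated makes this
    cover avoid [V].  A graph without isolated vertices in which every vertex is
    avoided by a vertex cover of size at most 3 has at most 6 vertices
    ([card_le6_of_avoiding_covers]), whence [#|P| <= 6].  The 7 vertices of [C_7]
    are too few for six classes, as a coalition needs three vertices to dominate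
    ([ic_partition_card_le5]).  For [n <= 6] the number of vertices is itself the
    bound.

    Lower bounds.  A colouring of the vertices together with a partner function
    [p] on colours yields an ic-partition as soon as every closed neighbourhood
    contains, for each colour [j], a vertex coloured [j] or [p j], each colour is
    absent from some closed neighbourhood, and adjacent vertices have neither
    equal nor partner colours ([ic_partition_colouring]).  On a cycle this only
    concerns the windows of three consecutive letters of the cyclic colour word,
    so it is decided by computation for a given word.  For unbounded lengths,
    two letters [x y] that together meet every pair [{j, p j}] can be repeated,
    since the only new windows are [xyx] and [yxy].  This gives all even
    [n >= 8] from a word of length 8 and all odd [n >= 11] from one of length
    11; [n = 9] has a word with another partner function.  For [n = 3] every
    singleton is dominating. *)

(** * Graphs with vertex covers avoiding each vertex *)
Lemma card_bigcup_le (I T : finType) (D : {set I}) (F : I -> {set T}) m :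
  (forall i, i \in D -> #|F i| <= m) -> #|\bigcup_(i in D) F i| <= #|D| * m.
Proof.
move=> leFm; rewrite -sum_nat_const.
apply: (@leq_trans (\sum_(i in D) #|F i|)); last exact: leq_sum.
elim/big_rec2: _ => [|i s A _ IH]; first by rewrite cards0.
by rewrite (leq_trans (leq_card_setU _ _)) ?leq_add2l.
Qed.

Section CoverAvoidance.
Variables (T : finType) (e : rel T) (P : {set T}).

Definition vertex_cover (S : {set T}) : bool :=
  [forall x in P, forall y in P, e x y ==> (x \in S) || (y \in S)].

Lemma vertex_coverP (S : {set T}) :
  reflect {in P &, forall x y, e x y -> x \notin S -> y \in S} (vertex_cover S).
Proof.
apply: (iffP forall_inP) => [cS x y Px Py exy xS | cS x Px].
  by have /forall_inP/(_ y Py) := cS x Px; rewrite exy (negPf xS).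
apply/forall_inP=> y Py; apply/implyP=> exy.
by case: (boolP (x \in S)) => //= xS; apply: cS xS.
Qed.

(** Choose covers [A] and [B] of size at most 3 with [s = #|A :&: B|] minimal.
    A vertex outside [A :|: B] has all its neighbours in [A :&: B].  If [b] is
    one of them, a cover [W] avoiding [b] contains it, and minimality gives
    [#|W :&: A|, #|W :&: B| >= s], while [A :&: B :&: W] misses [b]; so
    [W] has at most [3 - 2s + (s - 1) = 2 - s] elements outside [A :|: B].  In
    total there are at most [(6 - s) + s (2 - s) <= 6] vertices. *)
Lemma card_le6_of_avoiding_covers :
    {in P, forall x, exists2 y, y \in P & e x y} ->
    {in P, forall x, exists S, [/\ vertex_cover S, #|S| <= 3 & x \notin S]} ->
  #|P| <= 6.
Proof.
move=> nbr avoid.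
have [->|[x0 Px0]] := set_0Vmem P; first by rewrite cards0.
have [S0 [cS0 leS0 _]] := avoid _ Px0.
pose small S := vertex_cover S && (#|S| <= 3).
have sS0 : small S0 && small S0 by rewrite /small cS0 leS0.
case: (@arg_minnP _ (S0, S0) (fun X => small X.1 && small X.2)
                 (fun X => #|X.1 :&: X.2|) sS0) => -[A B] /=.
case/andP=> /andP[cA leA] /andP[cB leB] minAB.
set s := #|A :&: B| in minAB.
pose N b := [set v in P :\: (A :|: B) | e v b].
have leN b : b \in P :&: (A :&: B) -> #|N b| <= 2 - s.
  rewrite !inE => /and3P[Pb bA bB].
  have [W [cW leW bW]] := avoid _ Pb.
  have sW : small W by rewrite /small cW leW.
  have leWA : s <= #|W :&: A| by apply: (minAB (W, A)); rewrite /= sW /small cA leA.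
  have leWB : s <= #|W :&: B| by apply: (minAB (W, B)); rewrite /= sW /small cB leB.
  have leWAB : #|W :&: A :&: (W :&: B)| < s.
    apply/proper_card/properP; split.
      by apply/subsetP=> v; rewrite !inE => /andP[/andP[_ ->] /andP[_ ->]].
    by exists b; rewrite !inE ?bA ?bB ?(negPf bW).
  have subN : N b \subset W :\: (A :|: B).
    apply/subsetP=> v; rewrite !inE => /andP[/andP[vAB Pv] evb].
    rewrite vAB /=; apply: contraR bW => vW.
    by move/vertex_coverP: cW => /(_ v b Pv Pb evb vW).
  move: (subset_leq_card subN) leW leWA leWB leWAB.
  by rewrite cardsD setIUr cardsU; clear; lia.
have subP : P :\: (A :|: B) \subset \bigcup_(b in P :&: (A :&: B)) N b.
  apply/subsetP=> v PABv; have := PABv; rewrite !inE negb_or.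
  case/andP=> /andP[vA vB] Pv; have [b Pb evb] := nbr v Pv.
  apply/bigcupP; exists b; last by rewrite inE PABv.
  rewrite !inE Pb; move/vertex_coverP: cA => /(_ v b Pv Pb evb vA) ->.
  by move/vertex_coverP: cB => /(_ v b Pv Pb evb vB) ->.
have les : #|P :&: (A :&: B)| <= s by rewrite subset_leq_card ?subsetIr.
move: (leq_trans (subset_leq_card subP) (card_bigcup_le leN)) leA leB.
have : #|A :|: B| = #|A| + #|B| - s by rewrite cardsU.
have : s <= #|A| by rewrite subset_leq_card ?subsetIl.
have : #|P| <= #|A :|: B| + #|P :\: (A :|: B)|.
  by rewrite -(cardsID (A :|: B) P) leq_add2r subset_leq_card ?subsetIr.
move: les; clear; case: s => [|[|s]]; rewrite ?muln0 ?muln1; lia.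
Qed.

End CoverAvoidance.

(** * Upper bounds in graphs of maximum degree two *)
Section MaxDegreeTwo.
Variable G : sgraph.
Implicit Types (S V W : {set G}) (P : {set {set G}}).

Definition closed_nbhd (v : G) : {set G} := [set u | (u == v) || adj v u].

Lemma dominatingP S :
  reflect (forall v, exists2 u, u \in closed_nbhd v & u \in S) (dominating S).
Proof.
apply: (iffP forallP) => domS v.
  case/orP: (domS v) => [vS | /exists_inP[u uS vu]].
    by exists v; rewrite // inE eqxx.
  by exists u; rewrite // inE vu orbT.
have [u] := domS v; rewrite inE => /predU1P[-> -> // | vu uS].
by apply/orP; right; apply/exists_inP; exists u.
Qed.

Lemma independentP S :
  reflect {in S &, forall u v, ~~ adj u v} (independent S).
Proof.
apply: (iffP forall_inP) => [iS u v uS vS | iS u uS].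
  by have /forall_inP := iS u uS; apply.
by apply/forall_inP=> v; apply: iS.
Qed.

Lemma partition_card_le P : partition P [set: G] -> #|P| <= #|G|.
Proof.
move=> partP; rewrite -cardsT (card_partition partP) -sum1_card.
apply: leq_sum => V PV; rewrite card_gt0.
by apply: contraTneq PV => ->; case/and3P: partP.
Qed.

Hypothesis nbhd_le3 : forall v, #|closed_nbhd v| <= 3.

Lemma dominating_card S : dominating S -> #|G| <= #|S| * 3.
Proof.
move/dominatingP=> domS.
apply: leq_trans (card_bigcup_le (fun u _ => nbhd_le3 u)).
rewrite -cardsT subset_leq_card //; apply/subsetP=> v _.
have [u vu uS] := domS v; apply/bigcupP; exists u => //.
by move: vu; rewrite !inE eq_sym adj_sym.
Qed.

Hypothesis card_gt3 : 3 < #|G|.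

Variable P : {set {set G}}.
Hypothesis icP : ic_partition P.

Lemma ic_partner V : V \in P -> exists2 W, W \in P & ind_coalition V W.
Proof.
case/andP: icP => _ /forall_inP icP' PV; have := icP' V PV.
case/orP=> [/andP[/eqP V1 /dominating_card] | /andP[_ /exists_inP[W]]].
  by rewrite V1; lia.
by rewrite !inE => /andP[_ PW] cVW; exists W.
Qed.

(** The cover consists of the classes that meet the closed neighbourhood of a
    vertex not dominated by [V]: any coalition must meet that neighbourhood. *)
Lemma ic_avoiding_cover V : V \in P ->
  exists S : {set {set G}}, [/\ vertex_cover (@ind_coalition G) P S, #|S| <= 3 & V \notin S].
Proof.
move=> PV; have [W PW /and5P[_ iV _ ndV _]] := ic_partner PV.
case/andP: icP => /and3P[/eqP covP trivP _] _.
have : ~~ dominating V by move: ndV; rewrite /ind_dominating iV.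
rewrite negb_forall => /existsP[v]; rewrite negb_or => /andP[vV vnV].
exists (pblock P @: closed_nbhd v); split.
- apply/vertex_coverP => A B PA PB /and5P[_ _ _ _ /andP[_ /andP[_ domAB]]] nA.
  have /dominatingP/(_ v)[u vu] := domAB.
  rewrite inE => /orP[uA | uB].
    by rewrite -(def_pblock trivP PA uA) imset_f in nA.
  by rewrite -(def_pblock trivP PB uB) imset_f.
- exact: leq_trans (leq_imset_card _ _) (nbhd_le3 v).
- apply/imsetP=> -[u vu defV].
  have uV : u \in V by rewrite defV mem_pblock covP inE.
  move: vu; rewrite inE => /predU1P[uv | vu]; first by rewrite -uv uV in vV.
  by case/exists_inP: vnV; exists u.
Qed.

Lemma ic_partition_card_le6 : #|P| <= 6.
Proof. exact: card_le6_of_avoiding_covers ic_partner ic_avoiding_cover. Qed.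

(** Six classes on 7 vertices have total excess [\sum (#|A| - 1) = 1], so one
    class [V] is a pair and the others are singletons.  A coalition needs at
    least 3 vertices to dominate, hence involves [V]; then a cover avoiding [V]
    contains the five other classes, although it has at most 3 elements. *)
Lemma ic_partition_card_le5 : #|G| = 7 -> #|P| <= 5.
Proof.
move=> G7; rewrite leqNgt; apply/negP=> gtP5.
have P6 : #|P| = 6 by have := ic_partition_card_le6; lia.
have [partP _] := andP icP; have [_ _ nP0] := and3P partP.
have sumP := card_partition partP; rewrite cardsT G7 in sumP.
have P_gt0 V : V \in P -> 0 < #|V|.
  by move=> PV; rewrite card_gt0; apply: contraNneq nP0 => <-.
have excess : \sum_(A in P) #|A|.-1 = 1.
  apply: (@addnI (\sum_(A in P) 1)); rewrite -big_split /= sum1_card P6 -[6 + 1]/7 sumP.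
  by apply: eq_bigr => A /P_gt0/prednK; rewrite add1n.
have [V PV ltV1] : exists2 V, V \in P & 1 < #|V|.
  apply/exists_inP; rewrite -[X in is_true X]negbK negb_exists_in.
  apply/negP=> /forall_inP leP1; move: excess; rewrite big1 // => A PA.
  by have := leP1 A PA; case: #|A| => [|[]].
have single A : A \in P -> A != V -> #|A| = 1.
  move=> PA nAV; move: excess; rewrite (bigD1 V) //= (bigD1 A) ?PA //=.
  have := P_gt0 A PA; lia.
have only_V X Y : X \in P -> Y \in P -> ind_coalition X Y -> (X == V) || (Y == V).
  move=> PX PY /and5P[_ _ _ _ /andP[_ /andP[_ /dominating_card]]].
  rewrite G7 -[_ || _]negbK negb_or => leXY; apply/negP=> /andP[nXV nYV].
  move: leXY (leq_card_setU X Y).1; rewrite (single X) // (single Y) //.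
  by clear; lia.
have [S [cS leS VS]] := ic_avoiding_cover PV.
have subS : P :\ V \subset S.
  apply/subsetP=> X; rewrite !inE => /andP[nXV PX].
  have [Y PY cXY] := ic_partner PX.
  have YV : Y = V by have := only_V X Y PX PY cXY; rewrite (negPf nXV) => /eqP.
  apply: contraR VS => nXS; rewrite -YV.
  by move/vertex_coverP: cS => /(_ X Y PX PY cXY nXS).
have := subset_leq_card subS; have := cardsD1 V P; rewrite PV P6; lia.
Qed.

End MaxDegreeTwo.

(** * Partitions given by colourings *)
Section Colouring.
Variables (G : sgraph) (k : nat) (c : G -> nat).
Hypotheses (c_lt : forall v, c v < k) (c_onto : forall j, j < k -> exists v, c v = j).

Definition colour_class (j : nat) : {set G} := [set v | c v == j].

Definition colour_classes : {set {set G}} := [set colour_class j | j : 'I_k].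

Lemma mem_colour_classes j : j < k -> colour_class j \in colour_classes.
Proof. by move=> ltjk; apply/imsetP; exists (Ordinal ltjk). Qed.

Lemma colour_class_inj i j :
  i < k -> colour_class i = colour_class j -> i = j.
Proof.
move=> /c_onto[v cv] /setP/(_ v); rewrite !inE cv eqxx.
by move/esym/eqP.
Qed.

Lemma card_colour_classes : #|colour_classes| = k.
Proof.
rewrite card_imset ?card_ord // => i j eq_ij.
by apply: val_inj; apply: colour_class_inj eq_ij.
Qed.

Lemma partition_colour_classes : partition colour_classes [set: G].
Proof.
apply/and3P; split.
- rewrite eqEsubset subsetT; apply/subsetP=> v _; apply/bigcupP.
  by exists (colour_class (c v)); rewrite ?mem_colour_classes // inE.
- apply/trivIsetP=> _ _ /imsetP[i _ ->] /imsetP[j _ ->] nij.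
  rewrite -setI_eq0; apply: contraNT nij => /set0Pn[v].
  by rewrite !inE => /andP[/eqP <- /eqP->].
- apply/imsetP=> -[j _ /esym/eqP]; apply/negP/set0Pn.
  by have [v cv] := c_onto (ltn_ord j); exists v; rewrite inE cv.
Qed.

Lemma ic_partition_colouring (p : nat -> nat) :
    (forall j, j < k -> (p j < k) && (p j != j)) ->
    (forall u v, adj u v -> (c u != c v) && (c u != p (c v))) ->
    (forall j, j < k -> exists v, {in closed_nbhd v, forall u, c u != j}) ->
    (forall j v, j < k ->
       exists2 u, u \in closed_nbhd v & (c u == j) || (c u == p j)) ->
  ic_partition colour_classes.
Proof.
move=> p_ok proper avoid cover.
have undom j : j < k -> ~~ ind_dominating (colour_class j).
  move=> /avoid[v vj]; apply/negP=> /andP[_ /dominatingP/(_ v)[u vu]].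
  by rewrite inE (negPf (vj u vu)).
have indep j : independent (colour_class j).
  apply/independentP=> u v; rewrite !inE => /eqP cu /eqP cv.
  by apply/negP=> /proper; rewrite cu cv eqxx.
rewrite /ic_partition partition_colour_classes; apply/forall_inP=> V.
case/imsetP=> -[j ltjk] _ -> /=; have /andP[ltpk npj] := p_ok j ltjk.
rewrite undom //=; apply/orP; right.
apply/exists_inP; exists (colour_class (p j)).
  rewrite !inE mem_colour_classes // andbT.
  by apply: contraNneq npj => /(colour_class_inj ltpk) ->.
rewrite /ind_coalition !indep !undom //=; apply/and3P; split.
- rewrite -setI_eq0; apply: contraNT npj => /set0Pn[v].
  by rewrite !inE => /andP[/eqP <- /eqP <-].
- apply/independentP=> u v; rewrite !inE => /orP[]/eqP cu /orP[]/eqP cv;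
    apply/negP=> auv; have := proper u v auv; have := proper v u;
    by rewrite adj_sym => /(_ auv); rewrite cu cv eqxx ?andbF.
- apply/dominatingP=> v; have [u vu uj] := cover j v ltjk.
  by exists u; rewrite // !inE.
Qed.

End Colouring.

(** * Colour words on cycles *)
Lemma closed_nbhd_cycle n (i : cycle_graph n) :
  closed_nbhd i = [set ord_pred i; i; ordS i].
Proof.
apply/setP=> j; rewrite !inE /= /cycle_adj.
have -> : (j == i.+1 %[mod n]) = (j == ordS i).
  by rewrite -val_eqE /= (modn_small (ltn_ord j)).
have -> : (i == j.+1 %[mod n]) = (j == ord_pred i).
  by rewrite -(can2_eq (@ordSK n) (@ord_predK n)) eq_sym -val_eqE /=
             (modn_small (ltn_ord i)).
by rewrite (eq_sym i j); case: eqP => //= _; rewrite ?orbT // orbF orbC.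
Qed.

Lemma card_closed_nbhd_cycle n (i : cycle_graph n) : #|closed_nbhd i| <= 3.
Proof.
rewrite closed_nbhd_cycle (leq_trans (leq_card_setU _ _)) // cards1 addn1 ltnS.
by rewrite cards2; case: (_ != _).
Qed.

Fixpoint windows (s : seq nat) : seq (seq nat) :=
  if s is x :: ((y :: z :: _) as s') then [:: x; y; z] :: windows s' else [::].

Definition cyclic_windows (w : seq nat) := windows (w ++ take 2 w).

Lemma size_windows s : size (windows s) = size s - 2.
Proof.
elim: s => [|x [|y [|z s]] IH] //.
by rewrite -[LHS]/(size (windows [:: y, z & s])).+1 IH /= !subSS subn0.
Qed.

Lemma nth_windows s i : i < size (windows s) ->
  nth [::] (windows s) i = [:: nth 0 s i; nth 0 s i.+1; nth 0 s i.+2].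
Proof.
by elim: s i => [|x [|y [|z s]] IH] [|i] //; apply: IH.
Qed.

(** Appending the first two letters makes the windows wrap around, one for each
    starting position. *)
Lemma nth_cyclic_windows w i : 1 < size w -> i < size w ->
  nth [::] (cyclic_windows w) i
  = [:: nth 0 w i; nth 0 w (i.+1 %% size w); nth 0 w (i.+2 %% size w)].
Proof.
move=> w_gt1 lti; rewrite nth_windows; last first.
  by rewrite size_windows size_cat size_takel // addnK.
have nth_wrap j : j < size w + 2 -> nth 0 (w ++ take 2 w) j = nth 0 w (j %% size w).
  move=> ltj; rewrite nth_cat; case: ltnP => [ltjw | lewj]; first by rewrite modn_small.
  rewrite nth_take; last by lia.
  by rewrite -{2}(subnK lewj) modnDr modn_small //; lia.
by rewrite !nth_wrap ?(modn_small lti) //; lia.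
Qed.

(** Partner functions on colours are given by their list of values [p]. *)
Definition compatible (p : seq nat) (a b : nat) : bool :=
  [&& a != b, a != nth 0 p b & b != nth 0 p a].

Definition colour_ok (k : nat) (p : seq nat) (ws : seq (seq nat)) (j : nat) : bool :=
  [&& nth 0 p j < k, nth 0 p j != j,
      all (fun t => (j \in t) || (nth 0 p j \in t)) ws,
      has (fun t => j \in t) ws & has (fun t => j \notin t) ws].

(** A decidable form of the hypotheses of [ic_partition_colouring] for the
    cycle whose vertices are successively coloured by the letters of [w]. *)
Definition good_word (k : nat) (p w : seq nat) : bool :=
  [&& 1 < size w, all (gtn k) w, all (sorted (compatible p)) (cyclic_windows w) &
      all (colour_ok k p (cyclic_windows w)) (iota 0 k)].

Definition word_colouring n (w : seq nat) (i : cycle_graph n) : nat := nth 0 w i.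

Section GoodWord.
Variables (k : nat) (p w : seq nat).
Hypothesis good : good_word k p w.
Local Notation n := (size w).
Local Notation c := (@word_colouring n w).

(** This turns conditions on all closed neighbourhoods into conditions on the
    finite list of windows.  The index is [ord_pred v] because windows are listed
    by their first letter. *)
Lemma nbhd_window (v : cycle_graph n) :
  nth [::] (cyclic_windows w) (ord_pred v) = [:: c (ord_pred v); c v; c (ordS v)].
Proof.
have /andP[w_gt1 _] := good.
rewrite -{3 4}(ord_predK v); move: (ord_pred v) => u.
rewrite (nth_cyclic_windows w_gt1 (ltn_ord u)) /word_colouring /=.
by rewrite -(addn1 (u.+1 %% _)) modnDml addn1.
Qed.

Lemma size_cyclic_windows : size (cyclic_windows w) = n.
Proof.
have /andP[w_gt1 _] := good.
by rewrite size_windows size_cat size_takel // addnK.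
Qed.

Lemma nbhd_window_mem (v : cycle_graph n) :
  [:: c (ord_pred v); c v; c (ordS v)] \in cyclic_windows w.
Proof. by rewrite -nbhd_window mem_nth // size_cyclic_windows. Qed.

Lemma window_nbhd t : t \in cyclic_windows w ->
  exists v : cycle_graph n, t = [:: c (ord_pred v); c v; c (ordS v)].
Proof.
case/(nthP [::]) => i; rewrite size_cyclic_windows => lti <-.
by exists (ordS (Ordinal lti)); rewrite -nbhd_window ordSK.
Qed.

Lemma ic_partition_good_word : ic_partition (colour_classes k c) /\ #|colour_classes k c| = k.
Proof.
have /and4P[_ /(all_nthP 0) w_lt /allP proper /allP colours] := good.
have nbhdP (v : cycle_graph n) j : reflect (exists2 u, u \in closed_nbhd v & c u = j)
    (j \in [:: c (ord_pred v); c v; c (ordS v)]).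
  rewrite closed_nbhd_cycle !inE; apply: (iffP or3P) => [|[u]].
    by case=> /eqP->; [exists (ord_pred v) | exists v | exists (ordS v)];
       rewrite // !inE eqxx ?orbT.
  by rewrite !inE => /orP[/orP[]|] /eqP-> <-; [apply: Or31 | apply: Or32 | apply: Or33].
have onto j : j < k -> exists v, c v = j.
  move=> ltjk; have := colours j; rewrite mem_iota => /(_ ltjk).
  case/and5P=> _ _ _ /hasP[_ /window_nbhd[v ->] /nbhdP[u _ cu]] _.
  by exists u.
have c_lt (v : cycle_graph n) : c v < k by apply: w_lt.
split; last exact: card_colour_classes onto.
apply: (ic_partition_colouring c_lt onto (p := nth 0 p)).
- move=> j ltjk; have := colours j; rewrite mem_iota => /(_ ltjk).
  by case/and5P=> -> ->.
- move=> u v auv.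
  have := proper _ (nbhd_window_mem u); rewrite /= andbT.
  case/andP=> /and3P[pu1 pu2 pu3] /and3P[su1 su2 su3].
  have : v \in closed_nbhd u by rewrite inE auv orbT.
  rewrite closed_nbhd_cycle !inE => /orP[/orP[]|] /eqP v_eq.
  + by rewrite v_eq eq_sym pu1.
  + by rewrite v_eq adj_irrefl in auv.
  + by rewrite v_eq su1.
- move=> j ltjk; have := colours j; rewrite mem_iota => /(_ ltjk).
  case/and5P=> _ _ _ _ /hasP[_ /window_nbhd[v ->] /nbhdP vj].
  by exists v => u vu; apply/eqP=> cu; apply: vj; exists u.
- move=> j v ltjk; have := colours j; rewrite mem_iota => /(_ ltjk).
  case/and5P=> _ _ /allP/(_ _ (nbhd_window_mem v)) /orP[]/nbhdP[u vu cu] _ _;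
    by exists u; rewrite // cu eqxx ?orbT.
Qed.

End GoodWord.

Lemma cyclic_windows_extend x y r :
  cyclic_windows [:: x, y, x, y & r]
  = [:: [:: x; y; x], [:: y; x; y] & cyclic_windows [:: x, y & r]].
Proof. by rewrite /cyclic_windows /= !take0. Qed.

(** If [{x, y}] meets every pair [{j, p j}], then the two new windows do as well;
    all old windows survive, and with them the witnesses for a colour being
    present and being absent. *)
Lemma good_word_extend k p x y r :
    compatible p x y ->
    all (fun j => (j \in [:: x; y]) || (nth 0 p j \in [:: x; y])) (iota 0 k) ->
  good_word k p [:: x, y & r] -> good_word k p [:: x, y, x, y & r].
Proof.
move=> /and3P[nxy nxpy nypx] /allP xy_cover.
rewrite /good_word cyclic_windows_extend => /and4P[_ w_lt proper /allP colours].
apply/and4P; split => //.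
- by move: w_lt => /= /and3P[-> -> ->].
- by rewrite /= proper /compatible (eq_sym y x) nxy nxpy nypx.
apply/allP=> j kj; have /and5P[pj_lt pj_neq all_j has_j avoid_j] := colours j kj.
rewrite /colour_ok pj_lt pj_neq /= all_j has_j avoid_j !orbT !andbT.
have := xy_cover j kj; rewrite !inE.
by do 4![case: (_ == _)].
Qed.

(** The main family uses a double star of partners: 1 and 2 are partners of 0,
    4 and 5 are partners of 3.  So [{0, 3}] meets every pair of partners and the
    factor [0 3] can be repeated.  For odd length, a second block [1 2 3] makes
    the length 11; length 9 uses three disjoint pairs of partners instead. *)
Lemma good_word_long n : 8 <= n ->
  exists p w, size w = n /\ good_word 6 p w.
Proof.
have [-> _ | n_neq9 n_ge8] := eqVneq n 9.
  by exists [:: 3; 4; 5; 0; 1; 2], [:: 0; 1; 2; 0; 1; 2; 3; 4; 5].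
pose star := [:: 1; 0; 0; 4; 3; 3].
exists star.
pose r := if odd n then [:: 1; 2; 3; 1; 2; 3; 0; 4; 5] else [:: 1; 2; 3; 0; 4; 5].
suff grow m : exists s, size s = m.*2 + size r /\ good_word 6 star [:: 0, 3 & s].
  (* The shift by 2 accounts for the leading [0 3], which [s] does not contain. *)
  have [s [sz_s good_s]] := grow (n - (size r).+2)./2.
  exists [:: 0, 3 & s]; split=> //=; rewrite sz_s /r.
  by have := odd_double_half n; case: (odd n) => /=; lia.
elim: m => [|m [s [sz_s good_s]]].
  by exists r; rewrite /r; case: (odd n).
by exists [:: 0, 3 & s]; split; [rewrite /= sz_s; lia | apply: good_word_extend].
Qed.

(** For [n] from 4 to 6 all vertices have different colours, and two vertices at
    distance 2 (for 4 and 5) or 3 (for 6) form an independent dominating set. *)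
Lemma good_word_exists n : 4 <= n ->
  exists p w, size w = n /\ good_word (if n <= 6 then n else if n == 7 then 5 else 6) p w.
Proof.
case: n => [|[|[|[|[|[|[|[|n]]]]]]]] // _; last exact: good_word_long.
- by exists [:: 2; 3; 0; 1], (iota 0 4).
- by exists [:: 2; 3; 4; 0; 1], (iota 0 5).
- by exists [:: 3; 4; 5; 0; 1; 2], (iota 0 6).
- by exists [:: 1; 0; 0; 1; 2], [:: 0; 3; 2; 1; 2; 1; 4].
Qed.

Lemma ic_partition_triangle :
  exists P : {set {set cycle_graph 3}}, ic_partition P /\ #|P| = 3.
Proof.
pose c (i : cycle_graph 3) := val i.
have onto j : j < 3 -> exists i, c i = j by move=> ltj; exists (Ordinal ltj).
have c_lt i : c i < 3 by apply: ltn_ord.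
exists (colour_classes 3 c); split; last exact: card_colour_classes.
rewrite /ic_partition partition_colour_classes //; apply/forall_inP=> V.
case/imsetP=> j _ ->; have -> : colour_class c j = [set j].
  by apply/setP=> i; rewrite !inE.
rewrite cards1 /=; apply/orP; left; apply/dominatingP=> i.
exists j; rewrite ?inE //=.
by case: i j => [[|[|[|i]]] lti] [[|[|[|j]]] ltj].
Qed.

Theorem theorem3p13 (n : nat) (hn : 3 <= n) :
  has_ic_partition (cycle_graph n) /\
  IC (cycle_graph n) = (if n <= 6 then n else if n == 7 then 5 else 6).
Proof.
set m := (if n <= 6 then n else _).
have [P icP cardP] : exists2 P : {set {set cycle_graph n}}, ic_partition P & #|P| = m.
  have [n3 | n_neq3] := eqVneq n 3.
    by rewrite /m n3; have [P [icP cardP]] := ic_partition_triangle; exists P.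
  have [|p [w [sz_w good]]] := @good_word_exists n; first by rewrite ltn_neqAle eq_sym n_neq3.
  rewrite -/m in good; move: {+}m good => k good; subst n.
  have [icP cardP] := ic_partition_good_word good.
  by exists (colour_classes k (@word_colouring (size w) w)).
split; first by exists P.
apply/eqP; rewrite eqn_leq -{2}cardP leq_bigmax_cond // andbT.
apply/bigmax_leqP=> Q icQ.
have card_n : #|cycle_graph n| = n by apply: card_ord.
have nbhd := @card_closed_nbhd_cycle n.
rewrite /m; case: (leqP n 6) => [_ | n_gt6].
  by have /andP[partQ _] := icQ; have := partition_card_le partQ; rewrite card_n.
have card_gt3 : 3 < #|cycle_graph n| by rewrite card_n (leq_trans _ n_gt6).
case: eqP => [n7 | _]; last exact: ic_partition_card_le6 icQ.
by apply: ic_partition_card_le5 icQ _; rewrite // card_n.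
Qed.
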